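(* Let $S=\langle n_1,\ldots,n_p\rangle$ be a numerical semigroup with $p\ge 2$ minimal generators, and let $j\in\{1,\ldots,p\}$. The algorithm described in the context, applied to $S$ and $j$, converges in a finite number of iterations: it terminates after finitely many iterations and its output equals $\omega(S,n_j)$.
   Context: $\mathbb{Z}_+$ is the set of nonnegative integers. A numerical semigroup is a subset $S\subseteq\mathbb{Z}_+$ containing $0$, closed under addition, with $\mathbb{Z}_+\setminus S$ finite. $S=\langle n_1,\ldots,n_p\rangle$ means that $\{n_1,\ldots,n_p\}$ is the (unique) minimal system of generators of $S$, i.e. $S=\{\sum_{i=1}^p n_ix_i: x\in\mathbb{Z}_+^p\}$ and no proper subset generates $S$. The $\omega$-invariant: for $s\in S$, $\omega(S,s)$ is the smallest nonnegative integer $K$ such that for every finite family $s_1,\ldots,s_n$ of elements of $S$ with $\sum_{i=1}^n s_i-s\in S$ there is $\Omega\subseteq\{1,\ldots,n\}$ with $|\Omega|\le K$ and $\sum_{i\in\Omega}s_i-s\in S$. It is known that $\omega(S,s)=\max\{\sum_{i=1}^p x_i: x\in \mathrm{Minimals}\,\bigcup_{s'\in S}F(s+s')\}$, where $F(t)=\{x\in\mathbb{Z}_+^p:\sum_{i=1}^p n_ix_i=t\}$ and $\mathrm{Minimals}$ denotes the set of component-wise minimal elements. The algorithm, with input $S=\langle n_1,\ldots,n_p\rangle$ and $j$: Initialization. For each $k\neq j$ let $M_k$ be the optimal value of $$\min\; x_k\quad\text{s.t.}\quad n_kx_k-\sum_{i=1}^p n_iy_i=n_j,\quad x_k\in\mathbb{Z}_+,\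 y\in\mathbb{Z}_+^p,$$ and put $M_j=1$. Let $LB=\max_{k\neq j}M_k$, let $k_0\ne j$ attain this maximum, and let $\widehat{x}^0=M_{k_0}e_{k_0}$, where $e_{k_0}$ is the $k_0$-th unit vector of $\mathbb{R}^p$. Iteration $\ell=1,2,\ldots$: (1) Solve the integer linear problem $$\max\ \sum_{i=1}^p x_i$$ subject to $$x_i\le k_i^r(\widehat{x}_i^{\,r}-1)-M_i(k_i^r-1)\quad (i=1,\ldots,p,\ r=0,\ldots,\ell-1),$$ $$\sum_{i=1}^p k_i^r\ge 1\quad(r=0,\ldots,\ell-1),\qquad \sum_{i=1}^p n_ix_i-\sum_{i=1}^p n_iy_i=n_j,\qquad x_j=0,$$ $$x,y\in\mathbb{Z}_+^p,\qquad k_i^r\in\{0,1\}\quad (i=1,\ldots,p,\ r=0,\ldots,\ell-1).$$ If it is infeasible, stop. Otherwise let $x^\ell$ be the $x$-part of an (arbitrary) optimal solution and set $UB=\sum_{i=1}^p x_i^\ell$. (2) Solve $$\max\ \sum_{i=1}^p\psi_i\quad\text{s.t.}\quad x_i+\psi_i=x_i^\ell\ (i=1,\ldots,p),\quad \sum_{i=1}^p n_ix_i-\sum_{i=1}^p n_iy_i=n_j,\quad x,y\in\mathbb{Z}_+^p,\ \psi_i\ge 0\ (i=1,\ldots,p),$$ let $\widehat{x}^{\,\ell}$ be the $x$-part of an (arbitrary) optimal solution, and replace $LB$ by $\max\{LB,\sum_{i=1}^p\widehat{x}_i^{\,\ell}\}$. (3) If $LB\ge UB$, stop. Otherwise pass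 to iteration $\ell+1$. Output: $LB$. *)

(* Defs.v *)
From Stdlib Require Import Relation_Operators.
From mathcomp Require Import all_boot all_order all_algebra.
From mathcomp Require Import classical_sets cardinality reals.

Set Implicit Arguments.
Unset Strict Implicit.
Unset Printing Implicit Defensive.

Import Order.TTheory GRing.Theory Num.Theory.

Local Open Scope nat_scope.

Definition numerical_semigroup (S : set nat) : Prop :=
  [/\ S 0, forall a b, S a -> S b -> S (a + b) & cofinite_set S].

Definition generated (p : nat) (n : 'I_p -> nat) (A : {set 'I_p}) : set nat :=
  [set t | exists x : {ffun 'I_p -> nat}, t = \sum_(i in A) n i * x i]%classic.

(* Quantifying over sets of indices rather than of values makes the n i
   pairwise distinct: a repeated value could be dropped. *)
Definition minimal_generators (p : nat) (S : set nat) (n : 'I_p -> nat) : Prop :=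
  S = generated n [set: 'I_p] /\
  forall A : {set 'I_p}, A \proper [set: 'I_p] -> S <> generated n A.

(* t - s \in S, the difference being taken in the integers. *)
Definition diff_in (S : set nat) (t s : nat) : Prop := s <= t /\ S (t - s).

Definition omega_bound (S : set nat) (s K : nat) : Prop :=
  forall (m : nat) (t : 'I_m -> nat),
    (forall i, S (t i)) -> diff_in S (\sum_i t i) s ->
    exists Omega : {set 'I_m},
      #|Omega| <= K /\ diff_in S (\sum_(i in Omega) t i) s.

Definition is_omega (S : set nat) (s w : nat) : Prop :=
  omega_bound S s w /\ forall K, omega_bound S s K -> w <= K.

Definition is_maximizer (T : Type) (d : Order.disp_t) (V : porderType d)
    (feasible : T -> Prop) (obj : T -> V) (z : T) : Prop :=
  feasible z /\ forall z', feasible z' -> (obj z' <= obj z)%O.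

Definition is_minimizer (T : Type) (d : Order.disp_t) (V : porderType d)
    (feasible : T -> Prop) (obj : T -> V) (z : T) : Prop :=
  feasible z /\ forall z', feasible z' -> (obj z <= obj z')%O.

Notation vec p := {ffun 'I_p -> nat}.

Definition weight (p : nat) (n : 'I_p -> nat) (x : vec p) : nat :=
  \sum_i n i * x i.

Definition sumvec (p : nat) (x : vec p) : nat := \sum_i x i.

(* The variables are z = (x_k, y). *)
Definition init_feasible (p : nat) (n : 'I_p -> nat) (j k : 'I_p)
    (z : nat * vec p) : Prop :=
  let: (xk, y) := z in
  ((n k * xk)%N%:Z - (weight n y)%:Z = (n j)%:Z)%R.

Definition init_bounds (p : nat) (n : 'I_p -> nat) (j : 'I_p) (M : vec p) : Prop :=
  M j = 1 /\
  forall k, k != j ->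
    exists z, is_minimizer (init_feasible n j k) (fun z => z.1) z /\ M k = z.1.

(* The variables are z = (x, y, k), where k r i stands for k_i^r and the
   binary value is the image of the boolean under the coercion to nat;
   xh is the sequence of the points \hat x^0, ..., \hat x^(l-1).  The
   inequality is between integers, as its right-hand side may be negative. *)
Definition master_feasible (p : nat) (n : 'I_p -> nat) (j : 'I_p) (M : vec p)
    (xh : seq (vec p)) (z : vec p * vec p * ('I_(size xh) -> 'I_p -> bool)) : Prop :=
  let: (x, y, k) := z in
  [/\ forall (i : 'I_p) (r : 'I_(size xh)),
        ((x i)%:Z <= (k r i)%:Z * ((nth [ffun=> 0%N] xh r i)%:Z - 1)
                     - (M i)%:Z * ((k r i)%:Z - 1))%R,
      forall r : 'I_(size xh), 1 <= \sum_i k r i,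
      ((weight n x)%:Z - (weight n y)%:Z = (n j)%:Z)%R
    & x j = 0].

(* The variables are z = (x, y, psi); xl is the point x^l. *)
Definition reduce_feasible (R : realType) (p : nat) (n : 'I_p -> nat) (j : 'I_p)
    (xl : vec p) (z : vec p * vec p * ('I_p -> R)) : Prop :=
  let: (x, y, psi) := z in
  [/\ forall i : 'I_p, ((x i)%:R + psi i = (xl i)%:R)%R,
      ((weight n x)%:Z - (weight n y)%:Z = (n j)%:Z)%R
    & forall i, (0 <= psi i)%R].

(* Running M LB xh is the state between two iterations: xh lists the points
   \hat x^r found so far, so the next iteration has number size xh. *)
Inductive state (p : nat) : Type :=
  | Running of vec p & nat & seq (vec p)
  | Stopped of nat.

Arguments Stopped {p}.

Inductive start (p : nat) (n : 'I_p -> nat) (j : 'I_p) : state p -> Prop :=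
  | Start (M : vec p) (LB : nat) (k0 : 'I_p) :
      init_bounds n j M ->
      LB = \max_(k | k != j) M k ->
      k0 != j -> M k0 = LB ->
      start n j (Running M LB [:: [ffun i => if i == k0 then M k0 else 0]]).

(* One full iteration; the relation is nondeterministic because optimal
   solutions are arbitrary. *)
Inductive iteration (R : realType) (p : nat) (n : 'I_p -> nat) (j : 'I_p) :
    state p -> state p -> Prop :=
  | IterInfeasible M LB xh :
      ~ (exists z, @master_feasible p n j M xh z) ->
      iteration R n j (Running M LB xh) (Stopped LB)
  | IterStop M LB xh z w :
      is_maximizer (@master_feasible p n j M xh) (fun z => sumvec z.1.1) z ->
      is_maximizer (@reduce_feasible R p n j z.1.1)
        (fun w => \sum_i w.2 i)%R w ->
      maxn LB (sumvec w.1.1) >= sumvec z.1.1 ->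
      iteration R n j (Running M LB xh) (Stopped (maxn LB (sumvec w.1.1)))
  | IterNext M LB xh z w :
      is_maximizer (@master_feasible p n j M xh) (fun z => sumvec z.1.1) z ->
      is_maximizer (@reduce_feasible R p n j z.1.1)
        (fun w => \sum_i w.2 i)%R w ->
      maxn LB (sumvec w.1.1) < sumvec z.1.1 ->
      iteration R n j (Running M LB xh)
        (Running M (maxn LB (sumvec w.1.1)) (rcons xh w.1.1)).

Definition reachable (R : realType) (p : nat) (n : 'I_p -> nat) (j : 'I_p)
    (s : state p) : Prop :=
  exists2 s0, start n j s0 & clos_refl_trans (state p) (iteration R n j) s0 s.

Definition outputs (R : realType) (p : nat) (n : 'I_p -> nat) (j : 'I_p)
    (v : nat) : Prop :=
  reachable R n j (Stopped v).

(* The initialization can be carried out, the execution never gets stuck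
   (whenever an integer program of an iteration is feasible it has an optimal
   solution), and no choice of optimal solutions gives an infinite run. *)
Definition terminates (R : realType) (p : nat) (n : 'I_p -> nat) (j : 'I_p) : Prop :=
  [/\ exists s0, start n j s0,
      forall M LB xh, reachable R n j (Running M LB xh) ->
        exists s, iteration R n j (Running M LB xh) s
    & ~ exists f : nat -> state p,
          start n j (f 0) /\ forall l, iteration R n j (f l) (f l.+1)].

(* Main.v *)
Require Import Defs.
From mathcomp Require Import all_boot all_order all_algebra.
From mathcomp Require Import boolp classical_sets cardinality reals.
From mathcomp Require Import zify.

Set Implicit Arguments.
Unset Strict Implicit.
Unset Printing Implicit Defensive.

Import Order.TTheory GRing.Theory Num.Theory.

(** Identify a vector x of multiplicities with a multiset of generators.  The
    vectors x whose weight exceeds [n j] by an element of S form an up-set U,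
    and everything turns on the minimal vectors of U.

    First, the omega invariant is the largest coordinate sum of a minimal vector
    ([is_omega_max]).  It is at most that maximum: a family in S whose sum
    dominates [n j] expands to vectors whose sum lies above some minimal m, and
    m can be covered by at most [sumvec m] of these vectors ([cover_subsum]).
    It is at least that maximum: the multiset of generators described by a
    minimal m has no proper submultiset in U ([minimal_le_omega_bound]).

    Second, the algorithm enumerates minimal vectors.  The initial bounds M are
    the least multiples of the unit vectors in U, so each minimal vector lies in
    the box below M ([minimal_vle_bounds]), and the one minimal vector with a
    nonzero j-th coordinate is the j-th unit vector.  The master program is then
    the maximization of the coordinate sum over those vectors of U in the box,
    with zero j-th coordinate, that lie above no point found so far
    ([master_feasibleP]); the second program descends from its solution to a
    minimal vector ([reduce_maximizer_minimal]), necessarily a new one.  Since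
    the box is finite, the run stops ([no_infinite_run]).

    The lower bound is throughout the coordinate sum of a minimal vector and the
    largest among those found.  When the run stops, a minimal vector that has
    not been found is feasible for the master program
    ([minimal_covered_or_feasible]) unless it is the j-th unit vector, so its
    coordinate sum is at most the upper bound, which the lower bound has
    reached; if the master program is infeasible there is no such vector. *)

(** * Optimal solutions of bounded programs *)

Lemma minimizer_exists (T : Type) (P : T -> Prop) (obj : T -> nat) :
  (exists z, P z) -> exists z, is_minimizer P obj z.
Proof.
move=> [z Pz].
have exv : exists v, `[< exists2 z, P z & obj z = v >].
  by exists (obj z); apply/asboolP; exists z.
case: (ex_minnP exv) => v /asboolP [z0 Pz0 <-] vmin.
exists z0; split=> // z' Pz'; rewrite leEnat; apply: vmin.
by apply/asboolP; exists z'.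
Qed.

Lemma maximizer_exists (T : Type) (P : T -> Prop) (obj : T -> nat) (B : nat) :
  (forall z, P z -> obj z <= B) -> (exists z, P z) ->
  exists z, is_maximizer P obj z.
Proof.
move=> leB [z Pz].
have exv : exists v, `[< exists2 z, P z & obj z = v >].
  by exists (obj z); apply/asboolP; exists z.
have ubv v : `[< exists2 z, P z & obj z = v >] -> v <= B.
  by move=> /asboolP [z0 /leB + <-].
case: (ex_maxnP exv ubv) => v /asboolP [z0 Pz0 <-] vmax.
exists z0; split=> // z' Pz'; rewrite leEnat; apply: vmax.
by apply/asboolP; exists z'.
Qed.

(** * The up-set behind the omega invariant *)

Definition vle (p : nat) (x y : vec p) : Prop := forall i, x i <= y i.

(** The vectors satisfying the knapsack constraint shared by all the integer
    programs: those whose weight exceeds [n j] by an element of the semigroup. *)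
Definition upset (p : nat) (n : 'I_p -> nat) (j : 'I_p) (x : vec p) : Prop :=
  exists y : vec p, weight n x = n j + weight n y.

Definition minimal (p : nat) (n : 'I_p -> nat) (j : 'I_p) (x : vec p) : Prop :=
  upset n j x /\ forall y, upset n j y -> vle y x -> y = x.

Definition ray (p : nat) (k : 'I_p) (a : nat) : vec p :=
  [ffun i => if i == k then a else 0].

Section Vectors.
Variables (p : nat) (n : 'I_p -> nat) (j : 'I_p).
Implicit Types x y m : vec p.

Lemma sumvec_le x y : vle x y -> sumvec x <= sumvec y.
Proof. by move=> le_xy; apply: leq_sum => i _; apply: le_xy. Qed.

Lemma vle_sumvec_eq x y : vle x y -> sumvec y <= sumvec x -> x = y.
Proof.
move=> le_xy le_s; apply/ffunP => i; apply/eqP.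
have := leqif_sum (fun i (_ : true) => leqif_eq (le_xy i)).
rewrite -/(sumvec x) -/(sumvec y) => -[_].
by rewrite eqn_leq le_s sumvec_le // => /esym /forallP /(_ i).
Qed.

Lemma sumvec_ray (k : 'I_p) a : sumvec (ray k a) = a.
Proof.
rewrite /sumvec (bigD1 k) //= ffunE eqxx big1 ?addn0 // => i ik.
by rewrite ffunE (negPf ik).
Qed.

Lemma weight_ray (k : 'I_p) a : weight n (ray k a) = n k * a.
Proof.
rewrite /weight (bigD1 k) //= ffunE eqxx big1 ?addn0 // => i ik.
by rewrite ffunE (negPf ik) muln0.
Qed.

Lemma ray_vle (k : 'I_p) a x : a <= x k -> vle (ray k a) x.
Proof. by move=> le_a i; rewrite ffunE; case: eqP => [->|]. Qed.

Lemma upset_diffE x y :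
  ((weight n x)%:Z - (weight n y)%:Z = (n j)%:Z)%R <->
  weight n x = n j + weight n y.
Proof. lia. Qed.

Lemma upset_vle x y : upset n j x -> vle x y -> upset n j y.
Proof.
move=> [u hu] le_xy; exists [ffun i => u i + (y i - x i)].
have -> : weight n y = weight n x + weight n [ffun i => y i - x i].
  rewrite /weight -big_split; apply: eq_bigr => i _ /=.
  by rewrite ffunE -mulnDr subnKC.
rewrite hu -addnA; congr (_ + _); rewrite /weight -big_split.
by apply: eq_bigr => i _; rewrite !ffunE mulnDr.
Qed.

(** Minimizing the coordinate sum is enough for componentwise minimality, which
    is why the reducing program returns minimal vectors. *)
Lemma minimizer_minimal xl m :
  is_minimizer (fun x => upset n j x /\ vle x xl) (@sumvec p) m ->
  minimal n j m /\ vle m xl.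
Proof.
move=> [[um le_m] hmin]; split=> //; split=> // y uy le_y.
apply: vle_sumvec_eq => //; have /= := hmin y; rewrite leEnat; apply.
by split=> // i; apply: leq_trans (le_y i) (le_m i).
Qed.

Lemma minimizer_below x : upset n j x ->
  exists m, is_minimizer (fun y => upset n j y /\ vle y x) (@sumvec p) m.
Proof. by move=> ux; apply: minimizer_exists; exists x; split=> // i. Qed.

Lemma minimal_below x : upset n j x -> exists2 m, minimal n j m & vle m x.
Proof. by move=> /minimizer_below[m /minimizer_minimal[]]; exists m. Qed.

Lemma upset_ray_self : upset n j (ray j 1).
Proof.
exists [ffun=> 0]; rewrite weight_ray muln1 /weight big1 ?addn0 // => i _.
by rewrite ffunE muln0.
Qed.

Lemma minimal_sum_gt0 m : 0 < n j -> minimal n j m -> 0 < sumvec m.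
Proof.
move=> nj0 [[y hy] _]; rewrite lt0n; apply/eqP => /eqP.
rewrite /sumvec sum_nat_eq0 => /forallP m0.
have : weight n m = 0.
  by rewrite /weight big1 // => i _; rewrite (eqP (m0 i)) muln0.
by rewrite hy; lia.
Qed.

Lemma minimal_ray (k : 'I_p) a m :
  upset n j (ray k a) -> minimal n j m -> a <= m k -> m = ray k a.
Proof. by move=> ua [_ hm] /ray_vle le_a; rewrite (hm _ ua le_a). Qed.

Lemma minimal_le_ray (k : 'I_p) a m :
  upset n j (ray k a) -> minimal n j m -> m k <= a.
Proof.
move=> ua hm; case: (leqP (m k) a) => // lt_a.
by have := lt_a; rewrite (minimal_ray ua hm (ltnW lt_a)) ffunE eqxx ltnn.
Qed.

End Vectors.

(** * The omega invariant as a maximum over minimal vectors *)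

Lemma generators_gt0 (p : nat) (S : set nat) (n : 'I_p -> nat) :
  minimal_generators S n -> forall i, 0 < n i.
Proof.
move=> [hS hmin] i; rewrite lt0n; apply/eqP => ni0.
apply: (hmin [set~ i]).
  by rewrite properT; apply/eqP => /setP/(_ i); rewrite !inE eqxx.
rewrite hS /generated.
have E (x : vec p) :
    \sum_(k in [set: 'I_p]) n k * x k = \sum_(k in [set~ i]) n k * x k.
  rewrite (bigD1 i) ?inE //= ni0 mul0n add0n; apply: eq_bigl => k.
  by rewrite !inE.
by apply/seteqP; split=> t /= [x ->]; exists x; rewrite E.
Qed.

Lemma in_semigroupP (p : nat) (S : set nat) (n : 'I_p -> nat) t :
  minimal_generators S n -> S t <-> exists x : vec p, t = weight n x.
Proof.
move=> [-> _]; rewrite /generated /weight /=.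
have E (x : vec p) : \sum_(k in [set: 'I_p]) n k * x k = \sum_k n k * x k.
  by apply: eq_bigl => k; rewrite inE.
by split=> -[x ->]; exists x; rewrite E.
Qed.

Lemma diff_in_upset (p : nat) (S : set nat) (n : 'I_p -> nat) j (x : vec p) :
  minimal_generators S n -> diff_in S (weight n x) (n j) <-> upset n j x.
Proof.
move=> hn; split=> [[le_j /(in_semigroupP _ hn)[y hy]]|[y hy]].
  by exists y; rewrite -hy subnKC.
split; first by rewrite hy leq_addr.
by apply/(in_semigroupP _ hn); exists y; rewrite hy addKn.
Qed.

(** Raising an already covered vector by one unit in some coordinate costs at
    most one further term: if the chosen terms no longer suffice there, some
    term not yet chosen is positive in that coordinate. *)
Lemma cover_subsum (p m : nat) (a : 'I_m -> vec p) (x : vec p) :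
  (forall i, x i <= \sum_l a l i) ->
  exists2 Omega : {set 'I_m},
    #|Omega| <= sumvec x & forall i, x i <= \sum_(l in Omega) a l i.
Proof.
move: {2}(sumvec x) (erefl (sumvec x)) => K; elim: K x => [|K IH] x hx hle.
  exists finset.set0; rewrite ?cards0 // => i.
  by move/eqP: hx; rewrite sum_nat_eq0 => /forallP/(_ i)/eqP ->.
have [c xc0] : exists c, 0 < x c.
  apply/existsP; apply: contraPT isT => /existsPn x0.
  have : sumvec x = 0.
    by apply: big1 => i _; move: (x0 i); rewrite -eqn0Ngt => /eqP.
  by rewrite hx.
pose x' : vec p := [ffun i => x i - (i == c)].
have sx' : sumvec x = (sumvec x').+1.
  rewrite /sumvec (bigD1 c) //= [in RHS](bigD1 c) //= ffunE eqxx.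
  rewrite -addSn subn1 prednK //; congr (_ + _); apply: eq_bigr => i ic.
  by rewrite ffunE (negPf ic) subn0.
have [|i|Om cardOm leOm] := IH x'.
- by apply: succn_inj; rewrite -sx'.
- by apply: leq_trans (hle i); rewrite ffunE leq_subr.
case: (leqP (x c) (\sum_(l in Om) a l c)) => [le_c|lt_c].
  exists Om => [|i]; first by rewrite sx' ltnW.
  by have [->//|ic] := eqVneq i c; have := leOm i; rewrite ffunE (negPf ic) subn0.
have [l lOm al0] : exists2 l, l \notin Om & 0 < a l c.
  apply/exists_inP; apply: contraPT lt_c => /exists_inPn h.
  apply/negP; rewrite -leqNgt; apply: leq_trans (hle c) _.
  rewrite (bigID (mem Om)) /= [X in _ + X]big1 ?addn0 // => l lOm.
  by move: (h l lOm); rewrite -eqn0Ngt => /eqP.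
exists (l |: Om) => [|i]; first by rewrite cardsU1 lOm sx'.
rewrite big_setU1 //=; have := leOm i; rewrite ffunE.
by have [->|ic] := eqVneq i c; rewrite /= ?subn0; move: al0; lia.
Qed.

Lemma omega_bound_finType (S : set nat) s K (T : finType) (t : T -> nat) :
  omega_bound S s K -> (forall i, S (t i)) -> diff_in S (\sum_i t i) s ->
  exists Omega : {set T}, #|Omega| <= K /\ diff_in S (\sum_(i in Omega) t i) s.
Proof.
move=> hK St; rewrite (reindex _ (onW_bij _ (enum_val_bij T))) /=.
move=> /(hK _ (fun i => t (enum_val i)) (fun i => St _)) [Om [cOm hOm]].
exists [set enum_val i | i in Om].
split; first exact: leq_trans (leq_imset_card _ _) cOm.
by rewrite big_imset //= => i k _ _; apply: enum_val_inj.
Qed.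

Section Omega.
Variables (p : nat) (S : set nat) (n : 'I_p -> nat) (j : 'I_p).
Hypothesis hn : minimal_generators S n.

Lemma omega_bound_of_minimal v :
  (forall m, minimal n j m -> sumvec m <= v) -> omega_bound S (n j) v.
Proof.
move=> hv q t St hd.
have /choice[a ta] : forall l, exists x : vec p, t l = weight n x.
  by move=> l; apply/(in_semigroupP _ hn).
have sumE (A : {set 'I_q}) :
    \sum_(l in A) t l = weight n [ffun i => \sum_(l in A) a l i].
  rewrite (eq_bigr _ (fun l _ => ta l)) exchange_big /=; apply: eq_bigr => i _.
  by rewrite ffunE big_distrr.
have /(diff_in_upset _ _ hn) ut :
    diff_in S (weight n [ffun i => \sum_(l in [set: 'I_q]) a l i]) (n j).
  by rewrite -sumE; move: hd; congr diff_in; apply: eq_bigl => l; rewrite inE.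
have [m hm le_m] := minimal_below ut.
have [|Om cOm leOm] := @cover_subsum _ _ a m.
  by move=> i; have := le_m i; rewrite ffunE; under eq_bigl do rewrite inE.
exists Om; split; first exact: leq_trans cOm (hv m hm).
rewrite sumE; apply/(diff_in_upset _ _ hn); apply: upset_vle hm.1 _ => i.
by rewrite ffunE.
Qed.

(** A minimal vector m, read as a family of generators in which the i-th one
    occurs [m i] times, is a family without any proper admissible subfamily. *)
Lemma minimal_le_omega_bound m K :
  minimal n j m -> omega_bound S (n j) K -> sumvec m <= K.
Proof.
move=> [um hm] hK; pose T := {i : 'I_p & 'I_(m i)}.
have partE (Om : {set T}) :
    \sum_(l in Om) n (tag l) =
      weight n [ffun i => #|[set l in Om | tag l == i]|].
  rewrite /weight (partition_big (fun l : T => tag l) xpredT) //=.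
  apply: eq_bigr => i _; rewrite ffunE mulnC -sum_nat_const.
  by apply: eq_big => [l|l /andP[_ /eqP ->] //]; rewrite inE.
have fibre i : #|[set l : T | tag l == i]| = m i.
  rewrite -sum1_card; under eq_bigl do rewrite inE.
  under eq_bigl do rewrite -[_ == i]andbT.
  rewrite -(sig_big_dep (pred1 i) (fun i' => xpredT) (fun _ _ => 1)) /=.
  by rewrite big_pred1_eq sum1_card card_ord.
have St i : S (n i).
  by apply/(in_semigroupP _ hn); exists (ray i 1); rewrite weight_ray muln1.
have [|Om [cOm]] :=
    omega_bound_finType (t := fun l : T => n (tag l)) hK (fun l => St _).
  have -> : \sum_(l : T) n (tag l) = weight n m.
    rewrite (eq_bigl (fun l => l \in [set: T])); last by move=> l; rewrite inE.
    rewrite partE; congr weight; apply/ffunP => i; rewrite ffunE -[RHS]fibre.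
    by apply: eq_card => l; rewrite !inE.
  exact/diff_in_upset.
rewrite partE => /(diff_in_upset _ _ hn)/hm mE.
have sE h := congr1 (@sumvec p) (mE h).
rewrite -sE => [|i]; last first.
  rewrite ffunE -[X in _ <= X]fibre; apply: subset_leq_card.
  by apply/fintype.subsetP => l; rewrite !inE => /andP[].
apply: leq_trans cOm; rewrite -[leqRHS]sum1_card.
rewrite (partition_big (fun l : T => tag l) xpredT) //= leq_sum // => i _.
rewrite ffunE -sum1_card; apply: eq_leq.
by apply: eq_bigl => l; rewrite inE.
Qed.

Lemma is_omega_max v :
  (forall m, minimal n j m -> sumvec m <= v) ->
  (exists2 m, minimal n j m & sumvec m = v) -> is_omega S (n j) v.
Proof.
move=> hv [m hm mv]; split; first exact: omega_bound_of_minimal.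
by move=> K; rewrite -mv; apply: minimal_le_omega_bound.
Qed.

End Omega.

(** * The integer programs of the algorithm *)

Section Programs.
Variables (p : nat) (n : 'I_p -> nat) (j : 'I_p).
Implicit Types (x y m M : vec p) (xh : seq (vec p)).

(** The binary variables linearize a disjunction: [k r i] chooses a coordinate
    in which x stays strictly below the r-th point already found, so the cuts
    remove from the box below M exactly the vectors above a known point. *)
Lemma master_feasibleP M xh x :
  0 < size xh -> (forall m, m \in xh -> vle m M) ->
  (exists y k, @master_feasible p n j M xh (x, y, k)) <->
  [/\ upset n j x, x j = 0, vle x M & forall m, m \in xh -> ~ vle m x].
Proof.
move=> xh0 xhM; split=> [[y [k [cut one /upset_diffE eqw xj0]]]|].
  split=> //; first by exists y.
    move=> i; pose r := Ordinal xh0.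
    have := cut i r; have := xhM _ (mem_nth [ffun=> 0] xh0) i => /=.
    by case: (k r i) => /=; lia.
  move=> m /(nthP [ffun=> 0])[r ltr <-] le_x; pose r' := Ordinal ltr.
  have : \sum_i k r' i = 0.
    apply: big1 => i _; case kE: (k r' i) => //.
    by have := cut i r'; have := le_x i; rewrite kE /=; lia.
  by have := one r' => /[swap] ->.
move=> [[y /upset_diffE hy] xj0 xM ncov].
exists y, (fun r i => x i < nth [ffun=> 0] xh r i); split=> // [i r|r].
  by have := xM i; case: ltnP => /=; lia.
rewrite lt0n sum_nat_eq0; apply/negP => /forallP h.
apply: (ncov _ (mem_nth [ffun=> 0] (ltn_ord r))) => i.
by have := h i; rewrite /= eqb0 -leqNgt.
Qed.

Section Reduction.
Variable R : realType.

Lemma reduce_feasible_sum xl (w : vec p * vec p * ('I_p -> R)) :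
  reduce_feasible n j xl w ->
  [/\ upset n j w.1.1, vle w.1.1 xl &
      (\sum_i w.2 i = (sumvec xl)%:R - (sumvec w.1.1)%:R)%R].
Proof.
case: w => [[x y] psi] [eqx /upset_diffE hy psi0] /=; split.
- by exists y.
- by move=> i; rewrite -(ler_nat R) -eqx lerDl.
rewrite /sumvec !natr_sum -sumrB; apply: eq_bigr => i _.
by rewrite -eqx addrC addKr.
Qed.

Lemma reduce_feasible_exists xl x :
  upset n j x -> vle x xl ->
  exists2 w : vec p * vec p * ('I_p -> R), reduce_feasible n j xl w & w.1.1 = x.
Proof.
move=> [y hy] le_x; exists (x, y, fun i => ((xl i)%:R - (x i)%:R)%R) => //.
split=> [i||i]; first by rewrite addrC subrK.
  exact/upset_diffE.
by rewrite subr_ge0 ler_nat.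
Qed.

Lemma reduce_maximizer_minimal xl (w : vec p * vec p * ('I_p -> R)) :
  is_maximizer (@reduce_feasible R p n j xl) (fun w => \sum_i w.2 i)%R w ->
  minimal n j w.1.1 /\ vle w.1.1 xl.
Proof.
move=> [/reduce_feasible_sum[uw lew sw] wmax]; apply: minimizer_minimal.
split=> // x [ux lex]; have [w' fw' <-] := reduce_feasible_exists ux lex.
have := wmax _ fw'; have [_ _ ->] := reduce_feasible_sum fw'.
by rewrite sw lerD2l lerN2 ler_nat leEnat.
Qed.

Lemma reduce_maximizer_exists xl : upset n j xl ->
  exists w, is_maximizer (@reduce_feasible R p n j xl)
              (fun w => \sum_i w.2 i)%R w.
Proof.
move=> /minimizer_below[m [[um lem] hm]].
have [w fw wE] := reduce_feasible_exists um lem.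
exists w; split=> // w' /reduce_feasible_sum[uw' lew' ->].
have [_ _ ->] := reduce_feasible_sum fw.
by rewrite lerD2l lerN2 ler_nat wE -leEnat; apply: hm.
Qed.

End Reduction.

Lemma init_minimizer_exists (k : 'I_p) : 0 < n k ->
  exists z, is_minimizer (init_feasible n j k) (fun z => z.1) z.
Proof.
move=> nk0; apply: minimizer_exists.
(* n_k n_j - n_j is the multiple of n_j by n_k - 1. *)
exists (n j, ray j (n k).-1); rewrite /= weight_ray.
by case: (n k) nk0 => //= q _; lia.
Qed.

Lemma init_bounds_upset M i : init_bounds n j M -> upset n j (ray i (M i)).
Proof.
move=> [Mj Mk]; have [->|ij] := eqVneq i j.
  by rewrite Mj; apply: upset_ray_self.
have [[xk y] [[feas _] ->]] := Mk _ ij; exists y; rewrite weight_ray.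
by move: feas => /=; lia.
Qed.

Lemma init_bounds_minimal M k :
  init_bounds n j M -> k != j -> minimal n j (ray k (M k)).
Proof.
move=> hM kj; split; first exact: init_bounds_upset.
move=> y [u hu] le_y; have [z [[_ zmin] MkE]] := hM.2 _ kj.
have yE : y = ray k (y k).
  apply/ffunP => i; have := le_y i; rewrite !ffunE.
  by have [->//|_] := eqVneq i k; rewrite leqn0 => /eqP.
rewrite [LHS]yE; congr ray; apply/eqP; rewrite eqn_leq.
have := le_y k; rewrite ffunE eqxx => -> /=; rewrite MkE -leEnat.
by apply: (zmin (y k, u)); move: hu; rewrite yE weight_ray ffunE eqxx /=; lia.
Qed.

(** * The invariant of a run *)

(** All the points found are minimal and pairwise distinct, and the lower bound
    is the largest of their coordinate sums; a run may stop only once the bound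
    is the maximum over all minimal vectors. *)
Definition invariant (s : state p) : Prop :=
  match s with
  | Running M LB xh =>
      [/\ init_bounds n j M, forall x, x \in xh -> minimal n j x, uniq xh,
          exists2 x, x \in xh & sumvec x = LB
        & forall x, x \in xh -> sumvec x <= LB]
  | Stopped v =>
      (forall m, minimal n j m -> sumvec m <= v) /\
      exists2 m, minimal n j m & sumvec m = v
  end.

Lemma minimal_vle_bounds M m : init_bounds n j M -> minimal n j m -> vle m M.
Proof. by move=> hM hm i; apply: minimal_le_ray hm; apply: init_bounds_upset. Qed.

Lemma invariant_master_feasibleP M LB xh x : invariant (Running M LB xh) ->
  (exists y k, @master_feasible p n j M xh (x, y, k)) <->
  [/\ upset n j x, x j = 0, vle x M & forall m, m \in xh -> ~ vle m x].
Proof.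
move=> [hM mxh _ [x0 x0xh _] _]; apply: master_feasibleP.
  by case: xh x0xh {mxh}.
by move=> m /mxh; apply: minimal_vle_bounds.
Qed.

Lemma master_solution_upset M LB xh z : invariant (Running M LB xh) ->
  @master_feasible p n j M xh z ->
  [/\ upset n j z.1.1, vle z.1.1 M & forall m, m \in xh -> ~ vle m z.1.1].
Proof.
case: z => [[x y] k] hI fz.
by have /(_ _)[|]// := (invariant_master_feasibleP x hI).1; exists y, k.
Qed.

(** The box constraint loses no minimal vector.  One that is infeasible for the
    master program is either cut off by a point found earlier, hence equal to
    it, or has a positive j-th coordinate, hence is the j-th unit vector, whose
    coordinate sum 1 never exceeds LB. *)
Lemma minimal_covered_or_feasible M LB xh m : 0 < n j ->
  invariant (Running M LB xh) -> minimal n j m ->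
  sumvec m <= LB \/ exists2 z, @master_feasible p n j M xh z & z.1.1 = m.
Proof.
move=> nj0 hI hm; have [hM mxh _ [x0 x0xh LBE] leLB] := hI.
have [[x xxh lex]|ncov] := pselect (exists2 x, x \in xh & vle x m).
  by left; rewrite -(hm.2 _ (mxh _ xxh).1 lex) leLB.
have [mj|] := posnP (m j); last first.
  move=> /(minimal_ray (upset_ray_self n j) hm) ->; left.
  by rewrite sumvec_ray -LBE (minimal_sum_gt0 nj0) //; apply: mxh.
right; have [|y [k fz]] := (invariant_master_feasibleP m hI).2.
  split=> //; first exact: hm.1.
    exact: minimal_vle_bounds.
  by move=> x xxh lex; apply: ncov; exists x.
by exists (m, y, k).
Qed.

Lemma invariant_start s : start n j s -> invariant s.
Proof.
case=> M LB k0 hM _ k0j LBE; have hm := init_bounds_minimal hM k0j.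
split=> // [x||x].
- by rewrite inE => /eqP ->.
- by exists (ray k0 (M k0)); rewrite ?inE // sumvec_ray.
by rewrite inE => /eqP ->; rewrite -LBE -[leqRHS](sumvec_ray k0).
Qed.

Lemma invariant_add M LB xh x : invariant (Running M LB xh) ->
  minimal n j x -> x \notin xh ->
  invariant (Running M (maxn LB (sumvec x)) (rcons xh x)).
Proof.
move=> [hM mxh uxh [x0 x0xh LBE] leLB] hx xxh; split=> // [y||| y].
- by rewrite mem_rcons inE => /predU1P[->|/mxh].
- by rewrite rcons_uniq xxh.
- have [le_x|lt_x] := leqP (sumvec x) LB.
    by exists x0 => //; rewrite mem_rcons inE x0xh orbT.
  by exists x => //; rewrite mem_rcons inE eqxx.
rewrite mem_rcons inE leq_max => /predU1P[->|/leLB ->//].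
by rewrite leqnn orbT.
Qed.

Section Run.
Variable R : realType.

(** The point extracted from a master solution is new, since all the points
    found earlier have been cut off from below that solution. *)
Lemma invariant_extend M LB xh z w : invariant (Running M LB xh) ->
  is_maximizer (@master_feasible p n j M xh) (fun z => sumvec z.1.1) z ->
  is_maximizer (@reduce_feasible R p n j z.1.1)
    (fun w => \sum_i w.2 i)%R w ->
  invariant (Running M (maxn LB (sumvec w.1.1)) (rcons xh w.1.1)).
Proof.
move=> hI [fz _] /reduce_maximizer_minimal[hw lew]; apply: invariant_add => //.
have [_ _ ncov] := master_solution_upset hI fz.
by apply/negP => /ncov.
Qed.

Lemma invariant_iteration s s' : 0 < n j ->
  iteration R n j s s' -> invariant s -> invariant s'.
Proof.
move=> nj0 [M LB xh infeas|M LB xh z w zmax wmax le_z|M LB xh z w zmax wmax _] hI.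
- have [_ mxh _ [x0 /mxh mx0 x0E] _] := hI; split; last by exists x0.
  move=> m /(minimal_covered_or_feasible nj0 hI)[//|[z fz _]].
  by case: infeas; exists z.
- have [_ mxh _ [x0 /mxh mx0 x0E] _] := invariant_extend hI zmax wmax.
  split; last by exists x0.
  move=> m /(minimal_covered_or_feasible nj0 hI)[le_m|[z' fz' <-]].
    by rewrite leq_max le_m.
  by apply: leq_trans le_z; rewrite -leEnat; apply: zmax.2.
exact: invariant_extend zmax wmax.
Qed.

Lemma invariant_reachable s : 0 < n j -> reachable R n j s -> invariant s.
Proof.
move=> nj0 [s0 /invariant_start + run].
by elim: run => // [? ? /invariant_iteration|? ? ? _ IH1 _ IH2 /IH1/IH2]; auto.
Qed.

Lemma iteration_exists M LB xh : invariant (Running M LB xh) ->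
  exists s, iteration R n j (Running M LB xh) s.
Proof.
move=> hI; have [fex|infeas] := pselect (exists z, @master_feasible p n j M xh z).
  have [|z zmax] := @maximizer_exists _ _ (fun z => sumvec z.1.1) (sumvec M) _ fex.
    by move=> z /(master_solution_upset hI)[_ /sumvec_le].
  have [uz _ _] := master_solution_upset hI zmax.1.
  have [w wmax] := reduce_maximizer_exists R uz.
  have [le_z|lt_z] := leqP (sumvec z.1.1) (maxn LB (sumvec w.1.1)).
    by exists (Stopped (maxn LB (sumvec w.1.1))); apply: IterStop wmax le_z.
  by eexists; apply: IterNext wmax lt_z.
by exists (Stopped LB); apply: IterInfeasible.
Qed.

(** Distinct vectors of the box below M inject into a finite type. *)
Lemma size_uniq_box M xh : uniq xh -> (forall x, x \in xh -> vle x M) ->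
  size xh <= #|{ffun 'I_p -> 'I_(sumvec M).+1}|.
Proof.
move=> uxh xhM.
pose f x : {ffun 'I_p -> 'I_(sumvec M).+1} := [ffun i => inord (x i)].
have fK x i : x \in xh -> f x i = x i :> nat.
  move=> /xhM/(_ i) le_x; rewrite ffunE inordK // ltnS (leq_trans le_x) //.
  by rewrite /sumvec (bigD1 i) //= leq_addr.
have finj : {in xh &, injective f}.
  by move=> x y xxh yxh fE; apply/ffunP => i; rewrite -!fK // fE.
rewrite -(size_map f) -(card_uniqP _) ?max_card //.
by rewrite map_inj_in_uniq.
Qed.

Lemma no_infinite_run : 0 < n j ->
  ~ exists f : nat -> state p,
      start n j (f 0) /\ forall l, iteration R n j (f l) (f l.+1).
Proof.
move=> nj0 [f [f0 fS]].
have hI l : invariant (f l).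
  elim: l => [|l IH]; first exact: invariant_start.
  exact: invariant_iteration (fS l) IH.
have [M fl] : exists M, forall l, exists LB xh, f l = Running M LB xh /\ l < size xh.
  have [M [LB0 [xh0 f0E]]] :
      exists M LB xh, f 0 = Running M LB xh /\ 0 < size xh.
    by case: f0 => M LB k0 _ _ _ _; do 3 eexists.
  exists M; elim=> [|l [LB [xh [flE ltl]]]]; first by exists LB0, xh0.
  move: (fS l.+1); have := fS l; rewrite flE => it.
  inversion it as [| |? ? ? z w _ _ _]; subst=> it'; first by inversion it'.
    by inversion it'.
  by do 2 eexists; split; [reflexivity|rewrite size_rcons].
have [LB [xh [flE]]] := fl #|{ffun 'I_p -> 'I_(sumvec M).+1}|.
rewrite ltnNge; move: (hI #|{ffun 'I_p -> 'I_(sumvec M).+1}|); rewrite flE.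
move=> [hM mxh uxh _ _]; rewrite size_uniq_box // => x /mxh.
exact: minimal_vle_bounds.
Qed.

End Run.

Lemma start_exists : 1 < p -> (forall i, 0 < n i) -> exists s, start n j s.
Proof.
move=> p1 n0.
have /choice[z hz] : forall k, exists z,
    is_minimizer (init_feasible n j k) (fun z => z.1) z.
  by move=> k; apply: init_minimizer_exists.
pose M : vec p := [ffun k => if k == j then 1 else (z k).1].
have hM : init_bounds n j M.
  split=> [|k kj]; first by rewrite ffunE eqxx.
  by exists (z k); rewrite ffunE (negPf kj).
have : 0 < #|[pred k | k != j]|.
  by have := cardC1 j; rewrite card_ord -ltnS => ->; rewrite prednK // ltnW.
move=> /(eq_bigmax_cond M)[k0 k0j LBE].
exists (Running M (\max_(k | k != j) M k) [:: ray k0 (M k0)]).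
exact: Start.
Qed.

End Programs.

Theorem proposition3p2 (R : realType) (p : nat) (hp : 2 <= p)
    (S : set nat) (n : 'I_p -> nat)
    (hS : numerical_semigroup S) (hn : minimal_generators S n) (j : 'I_p) :
  terminates R n j /\ forall v, outputs R n j v -> is_omega S (n j) v.
Proof.
have n0 := generators_gt0 hn; split; first split.
- exact: start_exists.
- by move=> M LB xh /(invariant_reachable (n0 j)); apply: iteration_exists.
- exact: no_infinite_run (n0 j).
by move=> v /(invariant_reachable (n0 j))[]; apply: is_omega_max.
Qed.
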